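(* Let $A=(a_1,a_2,\dots)$ be an infinite sequence of real numbers with $a_i\le 1$ for all $i$, such that for every $k\in\mathbb{N}$ there is $n$ with $S_n=\sum_{j=1}^n a_j>k$. Then for every real number $a\ge 0$ there is a partition of $A$ into blocks $B_1,B_2,\dots$ with sizes $b_1,b_2,\dots$ such that $\inf_i b_i\le a\le\sup_i b_i\le\inf_i b_i+1$.
   Context: A block of a sequence is either the empty set or a set of consecutive terms $\{a_i,a_{i+1},\dots,a_j\}$ with $i\le j$; its size is the sum of its elements (the empty block has size $0$). A partition of the infinite sequence $A$ into blocks $B_1,B_2,\dots$ is given by a nondecreasing sequence of integers $0=x_0\le x_1\le x_2\le\dots$ with $x_i\to\infty$ and $B_i=\{a_j: x_{i-1}<j\le x_i\}$; every term lies in exactly one block, blocks appear in order, and empty blocks are allowed. *)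

(* Defs.v *)
From mathcomp Require Import all_boot all_order all_algebra.
From mathcomp Require Import all_classical all_reals all_analysis.

Set Implicit Arguments.
Unset Strict Implicit.
Unset Printing Implicit Defensive.

Import Order.TTheory GRing.Theory Num.Theory.
Import numFieldNormedType.Exports.

Local Open Scope classical_set_scope.
Local Open Scope ring_scope.

(* Terms and blocks are numbered from 0: [A j] stands for a_(j+1), and the
   i-th block below stands for B_(i+1). *)

(* The breakpoints 0 = x_0 <= x_1 <= x_2 <= ... -> oo of a partition of an
   infinite sequence into consecutive, possibly empty, blocks. *)
Definition block_partition (x : nat -> nat) : Prop :=
  [/\ x 0%N = 0%N,
      {homo x : i j / (i <= j)%N} &
      x i @[i --> \oo] --> \oo].

(* The terms a_j with x_i < j <= x_(i+1) are the [A j] with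
   x_i <= j < x_(i+1). *)
Definition block_size (R : realType) (A : nat -> R) (x : nat -> nat)
    (i : nat) : R :=
  \sum_(x i <= j < x i.+1) A j.

(* Main.v *)
(** Keeping only the times at which the partial sums reach a strict record,
    we may assume that the partial sums [T] increase to infinity with steps at
    most 1. A finite prefix of such a sequence can be cut into [k] blocks whose
    sizes lie in some [[c, c + 1]] with [c >= 0]: take for [c] the best possible
    minimal block size. A finite such chain can be prolonged forever by jumping
    to the first point above the current value plus [c], so a prefix having
    both a block of size at most [a] and one of size at least [a] suffices.

    Let [u k] be the first point with [T (u k) >= k * a]. If all its blocks have
    size at least [a], then [u] itself is a solution: [T (u k) < k * a + 1], so
    the block sizes have infimum [a]. Otherwise some block, from [u k] to
    [u k.+1], is smaller than [a]. Cut the prefix up to [u k.+1] into [k + 1]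
    blocks as above; some size is at least [a]. If all exceeded [a], the last
    breakpoint [w] before [u k.+1] would satisfy [T w >= k * a], hence
    [w >= u k], and the last block would be smaller than [a] after all. *)

Require Import Defs.
From mathcomp Require Import all_boot all_order all_algebra.
From mathcomp Require Import all_classical all_reals all_analysis.
From mathcomp Require Import lra.

Import Order.TTheory GRing.Theory Num.Theory.
Import numFieldNormedType.Exports.

Local Open Scope classical_set_scope.
Local Open Scope ring_scope.

(** * Finite chains of blocks *)

(** [T] stands for the partial sums, so [y] cuts the first [n] terms into [k] blocks with sizes in
    [P]; its values beyond [k] are free. *)
Definition chain {R : realType} (T : nat -> R) (P : R -> Prop) (k n : nat)
    (y : nat -> nat) : Prop :=
  [/\ y 0%N = 0%N, y k = n &
      forall i : nat, (i < k)%N ->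
        (y i <= y i.+1)%N /\ P (T (y i.+1) - T (y i))].

Definition reach {R : realType} (T : nat -> R) (P : R -> Prop) (k n : nat) :
  Prop := exists y, chain T P k n y.

Lemma reachS {R : realType} (T : nat -> R) (P : R -> Prop) (k n : nat) :
  reach T P k.+1 n <->
  exists m, [/\ (m <= n)%N, reach T P k m & P (T n - T m)].
Proof.
split=> [[y [y0 yn yP]]|[m [lemn [y [y0 ym yP]] Pnm]]].
  have [leyk Pk] := yP k (ltnSn k); rewrite yn in leyk Pk.
  exists (y k); split=> //; exists y; split=> // i ltik.
  exact/yP/ltnW.
exists (fun i => if (i <= k)%N then y i else n); split=> [//||i ltik].
  by rewrite ltnn.
have leik : (i <= k)%N by [].
rewrite leik; have [ltik1|leki] := ltnP i k; first exact: yP.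
have -> : i = k by apply/eqP; rewrite eqn_leq leik.
by rewrite ym.
Qed.

Lemma reach_sub {R : realType} (T : nat -> R) (P Q : R -> Prop) (k n : nat) :
  (forall b, P b -> Q b) -> reach T P k n -> reach T Q k n.
Proof.
move=> PQ [y [y0 yn yP]]; exists y; split=> // i /yP[leyi /PQ Qi].
by split.
Qed.

Lemma chain_telescope {R : realType} (T : nat -> R) (y : nat -> nat) (k : nat) :
  T 0%N = 0 -> y 0%N = 0%N ->
  T (y k) = \sum_(0 <= i < k) (T (y i.+1) - T (y i)).
Proof. by move=> T0 y0; rewrite (telescope_sumr (T \o y)) //= y0 T0 subr0. Qed.

Lemma chain_ge_mul {R : realType} (T : nat -> R) (y : nat -> nat) (a : R)
    (k : nat) :
  T 0%N = 0 -> y 0%N = 0%N ->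
  (forall i, (i < k)%N -> a <= T (y i.+1) - T (y i)) -> k%:R * a <= T (y k).
Proof.
move=> T0 y0 ge_a; rewrite (chain_telescope T y k T0 y0) mulr_natl.
rewrite big_mkord -[k in _ *+ k]card_ord -sumr_const.
by apply: ler_sum => i _; exact: ge_a.
Qed.

Lemma chain_le_mul {R : realType} (T : nat -> R) (y : nat -> nat) (a : R)
    (k : nat) :
  T 0%N = 0 -> y 0%N = 0%N ->
  (forall i, (i < k)%N -> T (y i.+1) - T (y i) <= a) -> T (y k) <= k%:R * a.
Proof.
move=> T0 y0 le_a; rewrite (chain_telescope T y k T0 y0) mulr_natl.
rewrite big_mkord -[k in _ *+ k]card_ord -sumr_const.
by apply: ler_sum => i _; exact: le_a.
Qed.

Lemma first_ge {R : realType} (T : nat -> R) (t : R) :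
  (forall k : nat, exists n, k%:R < T n) ->
  exists n, t <= T n /\ forall m, (m < n)%N -> T m < t.
Proof.
move=> unbT.
have [|n tn minn] := @ex_minnP (fun n => t <= T n).
  have [n ltn] := unbT (Num.bound `|t|); exists n.
  rewrite (le_trans (ler_norm t))// ltW// (lt_trans _ ltn)//.
  exact: archi_boundP.
exists n; split=> // m ltmn; rewrite ltNge; apply/negP => /minn.
by rewrite leqNgt ltmn.
Qed.

(** * Cutting a finite prefix into blocks of nearly equal size *)

(** Recursion on the last breakpoint [m]: the best minimum is the largest
    [Num.min (f m) (T n - T m)], attained because [m] ranges over a finite set. *)
Lemma best_min_block {R : realType} (T : nat -> R) (k n : nat) :
  T 0%N = 0 -> {homo T : i j / (i <= j)%N >-> i <= j} ->
  exists c, [/\ 0 <= c, reach T (fun b => c <= b) k.+1 n &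
                ~ reach T (fun b => c < b) k.+1 n].
Proof.
move=> T0 homoT; elim: k n => [n|k IH n].
  exists (T n); split; first by rewrite -T0 homoT.
    apply/reachS; exists 0%N; rewrite T0 subr0; split=> //.
    by exists (fun=> 0%N); split.
  by move=> /reachS[m [_ [y [-> <- _]]]]; rewrite T0 subr0 ltxx.
have [f fP] := choice IH.
pose F (m : 'I_n.+1) := Num.min (f m) (T n - T m).
have [m _ maxm] := @Order.TotalTheory.arg_maxP _ _ _ ord0 xpredT F isT.
have ltmn : (m <= n)%N by rewrite -ltnS.
have [fm0 reachm _] := fP m.
exists (F m); split.
- by rewrite le_min fm0 subr_ge0 homoT.
- apply/reachS; exists m; split=> //; last by rewrite ge_min lexx orbT.
  apply: reach_sub reachm => b; apply: le_trans.
  by rewrite ge_min lexx.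
- move=> /reachS[j [lejn reachj ltj]].
  have [_ _ Nreach] := fP j.
  (* Optimality of [f j] forces this; [F] at [j] would then exceed its maximum. *)
  have ltFf : F m < f j.
    rewrite ltNge; apply/negP => lefF; apply: Nreach.
    by apply: reach_sub reachj => b; exact: le_lt_trans.
  have leFm : F (Ordinal (lejn : (j < n.+1)%N)) <= F m by exact: maxm.
  by move: leFm; rewrite leNgt {2}/F /= lt_min ltFf ltj.
Qed.

(** The first point above [T m + c] overshoots by at most one step. Strictness makes jumps advance
    even for [c = 0] and lets them compete with an optimal [c]. *)
Lemma strict_greedy {R : realType} (T : nat -> R) (c : R) :
  {homo T : i j / (i <= j)%N >-> i <= j} ->
  (forall i, T i.+1 <= T i + 1) ->
  (forall k : nat, exists n, k%:R < T n) -> 0 <= c ->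
  exists g : nat -> nat, forall m,
    (m < g m)%N /\ c < T (g m) - T m <= c + 1.
Proof.
move=> homoT stepT unbT c0.
suff /choice[g gP] : forall m, exists n,
    (m < n)%N /\ c < T n - T m <= c + 1 by exists g.
move=> m; have [|n tn minn] := @ex_minnP (fun n => T m + c < T n).
  have [n ltn] := unbT (Num.bound `|T m + c|); exists n.
  by apply: le_lt_trans (ler_norm _) (lt_trans _ ltn); exact: archi_boundP.
have ltmn : (m < n)%N.
  rewrite ltnNge; apply/negP => /homoT; lra.
exists n; split=> //; apply/andP; split; first lra.
case: n ltmn tn minn => // n ltmn tn minn.
have : T n <= T m + c.
  by rewrite leNgt; apply/negP => /minn; rewrite ltnn.
have := stepT n; lra.
Qed.

(* The points reachable in [j] steps with sizes in [c, c + 1] form an interval: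
   consecutive points are at distance at most 1, the length of [c, c + 1]. *)
Lemma reach_between {R : realType} (T : nat -> R) (c : R) (L U : nat -> nat)
    (k : nat) :
  {homo T : i j / (i <= j)%N >-> i <= j} ->
  (forall i, T i.+1 <= T i + 1) -> 0 <= c ->
  L 0%N = 0%N -> U 0%N = 0%N ->
  (forall i, (i < k)%N -> (L i <= L i.+1)%N /\ c <= T (L i.+1) - T (L i)) ->
  (forall i, (U i <= U i.+1)%N /\ c <= T (U i.+1) - T (U i) <= c + 1) ->
  forall j m, (j <= k)%N -> (L j <= m <= U j)%N ->
  reach T (fun b => c <= b <= c + 1) j m.
Proof.
move=> homoT stepT c0 L0 U0 LP UP; elim=> [m _|j IH m ltjk /andP[leLm lemU]].
  rewrite L0 U0 => /andP[_]; rewrite leqn0 => /eqP->.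
  by exists (fun=> 0%N); split.
have [leL cL] := LP j ltjk; have [leU cU] := UP j.
have TLm := homoT _ _ leLm; have TmU := homoT _ _ lemU.
(* Take the last [y] at distance at least [c] from [m]. If it is at or past [U j], then [U j] serves
   as previous breakpoint; otherwise [y] does, by induction. *)
have exy : exists y, (y <= m)%N && (c <= T m - T y).
  by exists (L j); rewrite (leq_trans leL leLm)/=; lra.
have [||y /andP[leym cy] maxy] :=
  @ex_maxnP (fun y => (y <= m)%N && (c <= T m - T y)) m.
- exact: exy.
- by move=> y /andP[].
apply/reachS; have [leUy|ltyU] := leqP (U j) y.
  exists (U j); split; first exact: leq_trans leUy leym.
    by exists U; split.
  have := homoT _ _ leUy; lra.
exists y; split=> //.
  apply: IH; first exact: ltnW.
  rewrite (ltnW ltyU) andbT; apply: maxy.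
  by rewrite (leq_trans leL leLm)/=; lra.
rewrite cy/=; move: leym; rewrite leq_eqVlt => /orP[/eqP->|ltym]; first lra.
have : T m - T y.+1 < c.
  rewrite ltNge; apply/negP => cy1.
  by have := maxy y.+1; rewrite ltym cy1 ltnn => /(_ isT).
have := stepT y; lra.
Qed.

Lemma finite_block_partition {R : realType} (T : nat -> R) (k n : nat) :
  T 0%N = 0 -> {homo T : i j / (i <= j)%N >-> i <= j} ->
  (forall i, T i.+1 <= T i + 1) ->
  (forall k : nat, exists n, k%:R < T n) ->
  exists c, 0 <= c /\ reach T (fun b => c <= b <= c + 1) k.+1 n.
Proof.
move=> T0 homoT stepT unbT.
have [c [c0 [L [L0 Ln LP]] Nreach]] := best_min_block T k n T0 homoT.
exists c; split=> //.
have [g gP] := strict_greedy T c homoT stepT unbT c0.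
pose U i := iter i g 0%N.
have UP i : (U i <= U i.+1)%N /\ c < T (U i.+1) - T (U i) <= c + 1.
  by have [/ltnW] := gP (U i).
apply: (reach_between T c L U k.+1) => //.
  by move=> i; have [leU /andP[/ltW-> ->]] := UP i.
(* If the greedy chain stopped short of [n], stretching its last block to [n] would make every size
   exceed the optimal [c]. *)
rewrite Ln leqnn /= leqNgt; apply/negP => ltUn.
apply: Nreach; apply/reachS; exists (U k).
have [leU /andP[ltc _]] := UP k; split.
- exact: leq_trans leU (ltnW ltUn).
- by exists U; split=> // i _; have [? /andP[]] := UP i.
- have := homoT _ _ (ltnW ltUn); lra.
Qed.

(** * Infinite partitions for nondecreasing partial sums *)

(* The last condition allows an infimum equal to [a] that is not attained. *)
Definition balanced {R : realType} (T : nat -> R) (a : R) (y : nat -> nat) :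
  Prop :=
  [/\ y 0%N = 0%N, (forall i, (y i <= y i.+1)%N),
      (forall N, exists i, (N <= y i)%N) &
      exists c, [/\ forall i, c <= T (y i.+1) - T (y i) <= c + 1,
        exists i, a <= T (y i.+1) - T (y i) &
        forall e, 0 < e -> exists i, T (y i.+1) - T (y i) <= a + e]].

(** Blocks [i] and [j] already settle both comparisons with [a]; the greedy tail only has to keep
    sizes in [[c, c + 1]]. *)
Lemma chain_extend {R : realType} (T : nat -> R) (a c : R) (k n : nat)
    (y : nat -> nat) (i j : nat) :
  {homo T : i j / (i <= j)%N >-> i <= j} ->
  (forall i, T i.+1 <= T i + 1) ->
  (forall k : nat, exists n, k%:R < T n) -> 0 <= c ->
  chain T (fun b => c <= b <= c + 1) k n y ->
  (i < k)%N -> (j < k)%N ->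
  T (y i.+1) - T (y i) <= a -> a <= T (y j.+1) - T (y j) ->
  exists y', balanced T a y'.
Proof.
move=> homoT stepT unbT c0 [y0 yn yP] ltik ltjk lea gea.
have [g gP] := strict_greedy T c homoT stepT unbT c0.
pose z p := if (p <= k)%N then y p else iter (p - k) g n.
have z_ge p : (k <= p)%N -> z p = iter (p - k) g n.
  rewrite /z; case: (leqP p k) => // lepk lekp.
  have -> : p = k by apply/eqP; rewrite eqn_leq lepk.
  by rewrite subnn yn.
have zP p : (z p <= z p.+1)%N /\ c <= T (z p.+1) - T (z p) <= c + 1.
  have [ltpk|lekp] := ltnP p k.
    by rewrite /z (ltnW ltpk) ltpk; exact: yP.
  rewrite !z_ge ?(leqW lekp)// subSn //=.
  by have [/ltnW-> /andP[/ltW-> ->]] := gP (iter (p - k) g n).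
exists z; split=> //.
- by move=> p; have [] := zP p.
- move=> N; exists (k + N)%N; elim: N => // N IH.
  apply: leq_ltn_trans IH _; rewrite !z_ge ?leq_addr// !addKn iterS.
  by have [] := gP (iter N g n).
exists c; split.
- by move=> p; have [] := zP p.
- by exists j; rewrite /z (ltnW ltjk) ltjk.
- move=> e e0; exists i; rewrite /z (ltnW ltik) ltik; lra.
Qed.

Lemma balanced_nondecreasing {R : realType} (T : nat -> R) (a : R) :
  T 0%N = 0 -> {homo T : i j / (i <= j)%N >-> i <= j} ->
  (forall i, T i.+1 <= T i + 1) ->
  (forall k : nat, exists n, k%:R < T n) -> 0 <= a ->
  exists y, balanced T a y.
Proof.
move=> T0 homoT stepT unbT; rewrite le_eqVlt => /orP[/eqP<-|a0].
  (* For [a = 0], a single empty block is the chain to prolong. *)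
  apply: (chain_extend T 0 0 1 0 (fun=> 0%N) 0 0) => //;
    rewrite ?subrr //.
  by split=> // i _; rewrite subrr; split=> //; rewrite add0r lexx ler01.
have [u uP] := choice (fun k : nat => first_ge T (k%:R * a) unbT).
have u0 : u 0%N = 0%N.
  apply/eqP; rewrite -leqn0 leqNgt; apply/negP => /(proj2 (uP 0%N)).
  by rewrite T0 mul0r ltxx.
have ltu k : T (u k) < k%:R * a + 1.
  case E: (u k) => [|m]; first by rewrite T0 ltr_wpDl// mulr_ge0// ltW.
  have := proj2 (uP k) m; rewrite E => /(_ (ltnSn m)).
  have := stepT m; lra.
have [allge|] := pselect (forall k, a <= T (u k.+1) - T (u k)).
  exists u; split=> //.
  - move=> i; rewrite leqNgt; apply/negP => /ltnW/homoT.
    have := allge i; lra.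
  - move=> N; pose k := Num.bound (T N / a); exists k.
    have : T N / a < k%:R.
      by apply: archi_boundP; rewrite divr_ge0 ?(ltW a0)// -T0 homoT.
    rewrite ltr_pdivrMr// leqNgt => ltk; apply/negP => /ltnW/homoT.
    have [] := uP k; lra.
  - exists a; split.
    + move=> i; rewrite allge /=; have := ltu i.+1; have [] := uP i.
      rewrite -natr1 mulrDl mul1r; lra.
    + by exists 0%N.
    + move=> e e0; apply: contrapT => /forallNP H.
      (* Sizes all above [a + e] would give [T (u k) >= k * a + k * e], too large once
         [k * e > 1]. *)
      pose k := Num.bound e^-1.
      have ltek : 1 < k%:R * e.
        by rewrite -ltr_pdivrMr// div1r archi_boundP// invr_ge0 ltW.
      have : k%:R * (a + e) <= T (u k).
        apply: (chain_ge_mul T u _ k T0 u0) => i _.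
        rewrite leNgt; apply/negP => lti; exact: (H i (ltW lti)).
      have := ltu k; rewrite mulrDr; lra.
move=> /existsNP[k /negP]; rewrite -ltNge => ltk.
have [c [c0 [y yC]]] := finite_block_partition T k (u k.+1) T0 homoT stepT unbT.
have [y0 yn yP] := yC.
(* Were all sizes below [a], their total would be below [(k + 1) * a <= T (u k.+1)]. *)
have [j ltjk gej] : exists2 j, (j < k.+1)%N & a <= T (y j.+1) - T (y j).
  apply: contrapT => H.
  have lta i : (i < k.+1)%N -> T (y i.+1) - T (y i) < a.
    by move=> ltik; rewrite ltNge; apply/negP => ?; apply: H; exists i.
  have := chain_le_mul T y a k T0 y0 (fun i lti => ltW (lta i (ltnW lti))).
  have := lta k (ltnSn k); have [] := uP k.+1; rewrite yn.
  rewrite -natr1 mulrDl mul1r; lra.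
have [[i [ltik lei]]|H] :=
    pselect (exists i, (i < k.+1)%N /\ T (y i.+1) - T (y i) <= a).
  exact: (chain_extend T a c k.+1 (u k.+1) y i j).
have gta i : (i < k.+1)%N -> a < T (y i.+1) - T (y i).
  by move=> ltik; rewrite ltNge; apply/negP => ?; apply: H; exists i.
have geyk := chain_ge_mul T y a k T0 y0 (fun i lti => ltW (gta i (ltnW lti))).
have leuy : (u k <= y k)%N.
  rewrite leqNgt; apply/negP => /(proj2 (uP k)); lra.
have := homoT _ _ leuy; have := gta k (ltnSn k); rewrite yn; lra.
Qed.

(** * Reduction to record times *)

(* Records rise by at most 1 even though the sequence may fall arbitrarily
   far between them. *)
Lemma record_times {R : realType} (S : nat -> R) :
  S 0%N = 0 -> (forall n, S n.+1 <= S n + 1) ->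
  (forall k : nat, exists n, k%:R < S n) ->
  exists r : nat -> nat,
    [/\ r 0%N = 0%N, forall i, (r i < r i.+1)%N,
        forall i, S (r i) <= S (r i.+1) <= S (r i) + 1 &
        forall k : nat, exists i, k%:R < S (r i)].
Proof.
move=> S0 stepS unbS.
have /choice[nxt nxtP] : forall m, exists n,
    [/\ (m < n)%N, S m < S n & forall j, (m <= j < n)%N -> S j <= S m].
  move=> m.
  have [|n /andP[ltmn ltS] minn] :=
    @ex_minnP (fun n => (m < n)%N && (S m < S n)).
    (* The bound dominates every [S i] with [i <= m], so [n] must come after [m]. *)
    have [n ltn] := unbS (Num.bound (\sum_(i < m.+1) `|S i|)).
    have leSn i : (i <= m)%N -> S i < S n.
      move=> leim; apply: le_lt_trans (ler_norm _) (lt_trans _ ltn).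
      apply: le_lt_trans (archi_boundP _); last exact: sumr_ge0.
      rewrite (bigD1 (Ordinal (leim : (i < m.+1)%N)))//= lerDl.
      exact: sumr_ge0.
    exists n; rewrite leSn// andbT ltnNge; apply/negP => /leSn.
    by rewrite ltxx.
  exists n; split=> // j /andP[]; rewrite leq_eqVlt => /orP[/eqP->//|ltmj].
  move=> ltjn; rewrite leNgt; apply/negP => ltSj.
  by have := minn j; rewrite ltmj ltSj leqNgt ltjn => /(_ isT).
pose r i := iter i nxt 0%N.
have rP i : [/\ (r i < r i.+1)%N, S (r i) < S (r i.+1) &
    forall j, (r i <= j < r i.+1)%N -> S j <= S (r i)] by exact: nxtP.
exists r; split=> //.
- by move=> i; have [] := rP i.
- move=> i; have [ltr ltS leS] := rP i; rewrite (ltW ltS) andTb.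
  case: (r i.+1) ltr leS => // n; rewrite ltnS => len leS.
  by apply: le_trans (stepS n) _; rewrite lerD2r leS// len /=.
(* Before the next record [S] stays below the current one, so the records inherit unboundedness. *)
- have leSr i n : (n < r i.+1)%N -> S n <= S (r i).
    elim: i => [|i IH] ltn; first by have [_ _ ->] := rP 0%N.
    have [ltnr|lern] := ltnP n (r i.+1).
      by have [_ /ltW ltS _] := rP i; apply: le_trans ltS; exact: IH.
    by have [_ _ ->//] := rP i.+1; rewrite lern.
  have ltr i : (i < r i.+1)%N.
    elim: i => [|i IH]; first by have [] := rP 0%N.
    by have [ltr _ _] := rP i.+1; exact: leq_ltn_trans IH ltr.
  by move=> k; have [n ltn] := unbS k; exists n; apply: lt_le_trans ltn _;
    exact: leSr.
Qed.

Lemma balanced_block_sizes {R : realType} (T : nat -> R) (a : R)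
    (y : nat -> nat) :
  balanced T a y ->
  let b := range (fun i : nat => (T (y i.+1) - T (y i))%:E) in
  (ereal_inf b <= a%:E /\
   a%:E <= ereal_sup b /\
   ereal_sup b <= ereal_inf b + 1%:E)%E.
Proof.
move=> [_ _ _ [c [cP [i gei] lee]]] b.
split; [|split].
- apply/lee_addgt0Pr => e e0; have [j lej] := lee e e0.
  apply: (@le_trans _ _ (T (y j.+1) - T (y j))%:E).
    by apply: ereal_inf_lbound; exists j.
  by rewrite -EFinD lee_fin.
- apply: (@le_trans _ _ (T (y i.+1) - T (y i))%:E); first by rewrite lee_fin.
  by apply: ereal_sup_ubound; exists i.
- apply: (@le_trans _ _ (c%:E + 1%:E)%E).
    apply: ge_ereal_sup => _ [j _ <-]; rewrite -EFinD lee_fin.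
    by have /andP[] := cP j.
  apply: leeD => //; apply: le_ereal_inf_tmp => _ [j _ <-]; rewrite lee_fin.
  by have /andP[] := cP j.
Qed.

Theorem theorem3p2 (R : realType) (A : nat -> R)
    (hA1 : forall j : nat, A j <= 1)
    (hAunbounded : forall k : nat, exists n : nat,
       k%:R < \sum_(0 <= j < n) A j)
    (a : R) (ha : 0 <= a) :
  exists x : nat -> nat,
    block_partition x /\
    let b := range (fun i : nat => (block_size A x i)%:E) in
    (ereal_inf b <= a%:E /\
     a%:E <= ereal_sup b /\
     ereal_sup b <= ereal_inf b + 1%:E)%E.
Proof.
pose S n := \sum_(0 <= j < n) A j.
have S0 : S 0%N = 0 by rewrite /S big_geq.
have stepS n : S n.+1 <= S n + 1 by rewrite /S big_nat_recr//= lerD2l.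
have [r [r0 ltr rP unbr]] := record_times S S0 stepS hAunbounded.
have homor : {homo r : i j / (i <= j)%N}.
  by apply: homo_leq => // [|i]; [exact: leq_trans|exact: ltnW].
have homoSr : {homo S \o r : i j / (i <= j)%N >-> i <= j}.
  by apply/nondecreasing_seqP => i; have /andP[] := rP i.
have [y yb] : exists y, balanced (S \o r) a y.
  apply: balanced_nondecreasing => //=; first by rewrite r0.
  by move=> i; have /andP[] := rP i.
have [y0 leyS unby _] := yb.
have homoy : {homo y : i j / (i <= j)%N}.
  by apply: homo_leq => //; exact: leq_trans.
have ler i : (i <= r i)%N.
  by elim: i => // i IH; exact: leq_ltn_trans IH (ltr i).
(* [y] selects records and [r] gives their positions in [A]. *)
exists (r \o y); split.
  split; rewrite /= ?y0//.
    by move=> i j /homoy/homor.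
  apply/cvgnyPge => N; have [i leNi] := unby N.
  exists i => // j /= /homoy leij.
  exact: leq_trans (leq_trans leNi leij) (ler _).
have -> : (fun i => (block_size A (r \o y) i)%:E) =
    (fun i => ((S \o r) (y i.+1) - (S \o r) (y i))%:E).
  apply/funext => i; congr EFin; rewrite /block_size /S /=.
  by rewrite (big_cat_nat (leq0n _) (homor _ _ (leyS i)))/= [RHS]addrC addKr.
exact: balanced_block_sizes yb.
Qed.
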